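(* Let $k$ be a field, let $C$ be an arbitrary coalgebra over $k$, and let $A=DC=\operatorname{Hom}_k(C,k)$ be its dual algebra. Let $M$ and $N$ be right and left $C$-comodules, respectively. Then there is a natural isomorphism $$M\square_C N\;\cong\;\operatorname{Hom}_{A^e}(A,M\otimes N).$$
   Context: $\otimes=\otimes_k$. A right $C$-comodule $M$ with structure map $\Delta_M(m)=\sum m_0\otimes m_1\in M\otimes C$ is a left $A$-module by $a\cdot m=\sum m_0\,a(m_1)$; similarly a left $C$-comodule $N$ is a right $A$-module. The cotensor product $M\square_CN$ is the kernel of $\Delta_M\otimes1-1\otimes\Delta_N\colon M\otimes N\to M\otimes C\otimes N$. $A^e=A\otimes A^{\mathrm{op}}$, $A^e$-modules are identified with $A$-bimodules, and $M\otimes N$ is the $A$-bimodule with $a(m\otimes n)a'=am\otimes na'$. *)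

(* Defs.v *)
From HB Require Import structures.
From mathcomp Require Import all_boot all_algebra.
From mathcomp Require Import boolp.

Set Implicit Arguments.
Unset Strict Implicit.
Unset Printing Implicit Defensive.

Import GRing.Theory.
Local Open Scope ring_scope.
Local Open Scope quotient_scope.

Reserved Notation "V \ox W" (at level 40, left associativity).
Reserved Notation "v *t w" (at level 40, left associativity).


Section LinearMaps.

Lemma linear_ext (R : pzRingType) (U V : lmodType R) (f g : {linear U -> V}) :
  f =1 g -> f = g.
Proof.
case: f g => f [[f1] [f2]] [g [[g1] [g2]]] /= /funext fg.
case: _ / fg g1 g2 => g1 g2.
by rewrite (Prop_irrelevance f1 g1) (Prop_irrelevance f2 g2).
Qed.

HB.instance Definition _ (R : pzRingType) (U V : lmodType R) :=
  gen_eqMixin {linear U -> V}.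
HB.instance Definition _ (R : pzRingType) (U V : lmodType R) :=
  gen_choiceMixin {linear U -> V}.

Variables (R : pzRingType) (U V : lmodType R).
Implicit Types f g h : {linear U -> V}.

Definition lin_zero : {linear U -> V} := \0.
Definition lin_opp f : {linear U -> V} := \- f.
Definition lin_add f g : {linear U -> V} := f \+ g.

Lemma lin_addA : associative lin_add.
Proof. by move=> f g h; apply: linear_ext => x /=; rewrite addrA. Qed.
Lemma lin_addC : commutative lin_add.
Proof. by move=> f g; apply: linear_ext => x /=; rewrite addrC. Qed.
Lemma lin_add0 : left_id lin_zero lin_add.
Proof. by move=> f; apply: linear_ext => x /=; rewrite add0r. Qed.
Lemma lin_addN : left_inverse lin_zero lin_opp lin_add.
Proof. by move=> f; apply: linear_ext => x /=; rewrite addNr. Qed.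

HB.instance Definition _ :=
  GRing.isZmodule.Build {linear U -> V} lin_addA lin_addC lin_add0 lin_addN.

Lemma lin_addE f g x : (f + g) x = f x + g x. Proof. by []. Qed.
Lemma lin_oppE f x : (- f) x = - f x. Proof. by []. Qed.
Lemma lin_zeroE x : (0 : {linear U -> V}) x = 0. Proof. by []. Qed.

End LinearMaps.

Section LinearMapsScale.
Variables (k : comPzRingType) (U V : lmodType k).
Implicit Types f g : {linear U -> V}.

Definition lin_scale (a : k) f : {linear U -> V} := a \*: f.

Lemma lin_scaleA a b f : lin_scale a (lin_scale b f) = lin_scale (a * b) f.
Proof. by apply: linear_ext => x /=; rewrite scalerA. Qed.
Lemma lin_scale1 : left_id 1 lin_scale.
Proof. by move=> f; apply: linear_ext => x /=; rewrite scale1r. Qed.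
Lemma lin_scaleDr : right_distributive lin_scale +%R.
Proof. by move=> a f g; apply: linear_ext => x /=; rewrite scalerDr. Qed.
Lemma lin_scaleDl f : {morph lin_scale^~ f : a b / a + b}.
Proof. by move=> a b; apply: linear_ext => x /=; rewrite scalerDl. Qed.

HB.instance Definition _ :=
  GRing.Zmodule_isLmodule.Build k {linear U -> V}
    lin_scaleA lin_scale1 lin_scaleDr lin_scaleDl.

Lemma lin_scaleE a f x : (a *: f) x = a *: f x. Proof. by []. Qed.
End LinearMapsScale.

(* Tensor product of vector spaces, presented by generators and relations:
   the list [:: (v_1, w_1); ...; (v_n, w_n)] stands for \sum_i v_i *t w_i.
   tens_liftE and tens_lin_ext give the universal property. *)

Section Tensor.
Variables (k : fieldType) (V W : lmodType k).

Inductive tens_cong : seq (V * W) -> seq (V * W) -> Prop :=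
| TcRefl s : tens_cong s s
| TcSym s t : tens_cong s t -> tens_cong t s
| TcTrans s t u : tens_cong s t -> tens_cong t u -> tens_cong s u
| TcCat s s' t t' : tens_cong s s' -> tens_cong t t' ->
    tens_cong (s ++ t) (s' ++ t')
| TcComm s t : tens_cong (s ++ t) (t ++ s)
| TcZero w : tens_cong [:: (0, w)] [::]
| TcAddl v v' w : tens_cong [:: (v + v', w)] [:: (v, w); (v', w)]
| TcAddr v w w' : tens_cong [:: (v, w + w')] [:: (v, w); (v, w')]
| TcScale a v w : tens_cong [:: (a *: v, w)] [:: (v, a *: w)].

Definition tens_rel (s t : seq (V * W)) : bool := `[< tens_cong s t >].

Lemma tens_rel_equiv : equiv_class_of tens_rel.
Proof.
split=> [s|s t|t s u]; first by apply/asboolP; exact: TcRefl.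
  by apply/asboolP/asboolP; exact: TcSym.
by move=> /asboolP st /asboolP tu; apply/asboolP; exact: TcTrans st tu.
Qed.

Canonical tens_equiv := EquivRelPack tens_rel_equiv.

Definition tensor : Type := {eq_quot tens_equiv}.
HB.instance Definition _ := Choice.on tensor.
HB.instance Definition _ := Quotient.on tensor.
HB.instance Definition _ := EqQuotient.on tensor.

Lemma tens_piP s t : reflect (\pi_tensor s = \pi_tensor t) `[< tens_cong s t >].
Proof. exact: (eqmodP tens_equiv). Qed.

Lemma tens_pi s t : tens_cong s t -> \pi_tensor s = \pi_tensor t.
Proof. by move=> st; apply/tens_piP/asboolP. Qed.

Lemma tens_repr_cong s : tens_cong (repr (\pi_tensor s)) s.
Proof. by apply/asboolP/tens_piP; rewrite reprK. Qed.

Definition tens_add (x y : tensor) : tensor := \pi_tensor (repr x ++ repr y).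
Definition tens_scale (a : k) (x : tensor) : tensor :=
  \pi_tensor [seq (a *: p.1, p.2) | p <- repr x].
Definition tens_zero : tensor := \pi_tensor [::].

Lemma tens_add_pi s t : tens_add (\pi s) (\pi t) = \pi_tensor (s ++ t).
Proof. by apply: tens_pi; apply: TcCat; exact: tens_repr_cong. Qed.

Lemma tens_scale_cong a s t : tens_cong s t ->
  tens_cong [seq (a *: p.1, p.2) | p <- s] [seq (a *: p.1, p.2) | p <- t].
Proof.
elim=> {s t} [s|s t _|s t u _ + _|s s' t t' _ IH _ IH'|s t|w|v v' w|v w w'|b v w] /=.
- exact: TcRefl.
- exact: TcSym.
- exact: TcTrans.
- by rewrite !map_cat; exact: TcCat.
- by rewrite !map_cat; exact: TcComm.
- by rewrite scaler0; exact: TcZero.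
- by rewrite scalerDr; exact: TcAddl.
- exact: TcAddr.
- by rewrite scalerA mulrC -scalerA; exact: TcScale.
Qed.

Lemma tens_scale_pi a s :
  tens_scale a (\pi s) = \pi_tensor [seq (a *: p.1, p.2) | p <- s].
Proof. by apply/tens_pi/tens_scale_cong/tens_repr_cong. Qed.

Lemma tens_ind_pi (P : tensor -> Prop) : (forall s, P (\pi s)) -> forall x, P x.
Proof. by move=> Ppi x; rewrite -[x]reprK. Qed.

Lemma tens_addA : associative tens_add.
Proof.
elim/tens_ind_pi=> s; elim/tens_ind_pi=> t; elim/tens_ind_pi=> u.
by rewrite !tens_add_pi catA.
Qed.

Lemma tens_addC : commutative tens_add.
Proof.
elim/tens_ind_pi=> s; elim/tens_ind_pi=> t.
by rewrite !tens_add_pi; apply/tens_pi/TcComm.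
Qed.

Lemma tens_add0 : left_id tens_zero tens_add.
Proof. by elim/tens_ind_pi=> s; rewrite tens_add_pi. Qed.

Lemma tens_scaleDl x : {morph tens_scale^~ x : a b / a + b >-> tens_add a b}.
Proof.
move=> a b; elim/tens_ind_pi: x => s; rewrite !tens_scale_pi tens_add_pi.
apply: tens_pi; elim: s => [|[v w] s IH] /=; first exact: TcRefl.
rewrite scalerDl.
apply: TcTrans (TcCat (TcAddl _ _ w) IH) _ => /=.
apply: (@TcCat [:: (a *: v, w)] [:: (a *: v, w)]); first exact: TcRefl.
rewrite -[X in tens_cong _ (_ ++ X)]cat1s -[X in tens_cong X]cat1s !catA.
by apply: TcCat; [exact: TcComm | exact: TcRefl].
Qed.

Lemma tens_scale0 x : tens_scale 0 x = tens_zero.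
Proof.
elim/tens_ind_pi: x => s; rewrite tens_scale_pi; apply: tens_pi.
elim: s => [|[v w] s IH] /=; first exact: TcRefl.
by rewrite scale0r; apply: (@TcCat [:: (0, w)] [::] _ [::]); first exact: TcZero.
Qed.

Lemma tens_scale1 : left_id 1 tens_scale.
Proof.
elim/tens_ind_pi=> s; rewrite tens_scale_pi; congr (\pi _).
by rewrite -[RHS]map_id; apply: eq_map => -[v w] /=; rewrite scale1r.
Qed.

Definition tens_opp (x : tensor) := tens_scale (-1) x.

Lemma tens_addN : left_inverse tens_zero tens_opp tens_add.
Proof.
by move=> x; rewrite -{2}[x]tens_scale1 -tens_scaleDl addNr tens_scale0.
Qed.

HB.instance Definition _ :=
  GRing.isZmodule.Build tensor tens_addA tens_addC tens_add0 tens_addN.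

Lemma tens_scaleA a b x : tens_scale a (tens_scale b x) = tens_scale (a * b) x.
Proof.
elim/tens_ind_pi: x => s; rewrite !tens_scale_pi -map_comp; congr (\pi _).
by apply: eq_map => -[v w] /=; rewrite scalerA.
Qed.

Lemma tens_scaleDr : right_distributive tens_scale +%R.
Proof.
move=> a; elim/tens_ind_pi=> s; elim/tens_ind_pi=> t.
by rewrite [in LHS]/+%R [in RHS]/+%R /= !(tens_add_pi, tens_scale_pi) map_cat.
Qed.

HB.instance Definition _ := GRing.Zmodule_isLmodule.Build k tensor
  tens_scaleA tens_scale1 tens_scaleDr tens_scaleDl.

Definition tens (v : V) (w : W) : tensor := \pi_tensor [:: (v, w)].

Lemma tens_bilinear : bilinear_for *:%R *:%R tens.
Proof.
split=> [w a v v'|v a w w'] /=.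
  have -> : a *: tens v w = \pi_tensor [:: (a *: v, w)] by exact: tens_scale_pi.
  by rewrite [RHS]tens_add_pi; apply/tens_pi/TcAddl.
have -> : a *: tens v w = \pi_tensor [:: (a *: v, w)] by exact: tens_scale_pi.
rewrite [RHS]tens_add_pi; apply/tens_pi/(TcTrans (TcAddr _ _ _)).
apply: (@TcCat [:: _] [:: _] [:: _] [:: _]); last exact: TcRefl.
exact/TcSym/TcScale.
Qed.

HB.instance Definition _ :=
  bilinear_isBilinear.Build k V W tensor *:%R *:%R tens tens_bilinear.

Lemma tensDl v v' w : tens (v + v') w = tens v w + tens v' w.
Proof. exact: linearDl. Qed.
Lemma tensDr v w w' : tens v (w + w') = tens v w + tens v w'.
Proof. exact: linearDr. Qed.
Lemma tensZl a v w : tens (a *: v) w = a *: tens v w.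
Proof. by rewrite linearZl_LR. Qed.
Lemma tensZr a v w : tens v (a *: w) = a *: tens v w.
Proof. by rewrite linearZr_LR. Qed.

Lemma tens_piE s : \pi_tensor s = \sum_(p <- s) tens p.1 p.2.
Proof.
elim: s => [|[v w] s IH]; first by rewrite big_nil.
by rewrite big_cons -IH [RHS]tens_add_pi.
Qed.

Lemma tens_ind (P : tensor -> Prop) :
    (forall v w, P (tens v w)) -> P 0 -> (forall x y, P x -> P y -> P (x + y)) ->
  forall x, P x.
Proof.
move=> Pt P0 PD; elim/tens_ind_pi=> s; rewrite tens_piE.
by apply: big_ind => // p _; exact: Pt.
Qed.

Lemma tens_lin_ext (Z : zmodType) (s : k -> Z -> Z)
    (f g : {linear tensor -> Z | s}) :
  (forall v w, f (tens v w) = g (tens v w)) -> f =1 g.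
Proof.
move=> fg; elim/tens_ind=> [v w||x y IHx IHy]; first exact: fg.
  by rewrite !raddf0.
by rewrite !raddfD /= IHx IHy.
Qed.

Section Lift.
Variable Z : lmodType k.

Definition tens_lift (f : V -> W -> Z) (x : tensor) : Z :=
  \sum_(p <- repr x) f p.1 p.2.

Variable f : {bilinear V -> W -> Z}.

Lemma tens_lift_pi s : tens_lift f (\pi s) = \sum_(p <- s) f p.1 p.2.
Proof.
rewrite /tens_lift; move: (repr _) (tens_repr_cong s) => r.
elim=> {r s} [//|s t _ -> //|s t u _ -> _ -> //|s s' t t' _ IH _ IH'|s t|w|v v' w|v w w'|a v w].
- by rewrite !big_cat /= IH IH'.
- by rewrite !big_cat /= addrC.
- by rewrite big_seq1 big_nil /= linear0l.
- by rewrite !big_cons !big_nil /= linearDl !addr0 ?addrA.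
- by rewrite !big_cons !big_nil /= linearDr !addr0 ?addrA.
- by rewrite !big_seq1 /= linearZl_LR linearZr_LR.
Qed.

Lemma tens_lift_linear : linear (tens_lift f).
Proof.
move=> a; elim/tens_ind_pi=> s; elim/tens_ind_pi=> t.
have -> : a *: \pi_tensor s + \pi t
    = \pi_tensor ([seq (a *: p.1, p.2) | p <- s] ++ t).
  by rewrite -[RHS]tens_add_pi -tens_scale_pi.
rewrite !tens_lift_pi big_cat big_map scaler_sumr; congr (_ + _).
by apply: eq_bigr => p _ /=; rewrite linearZl_LR.
Qed.

HB.instance Definition _ :=
  GRing.isLinear.Build k tensor Z *:%R (tens_lift f) tens_lift_linear.

Lemma tens_liftE v w : tens_lift f (tens v w) = f v w.
Proof. by rewrite tens_lift_pi big_seq1. Qed.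

End Lift.
End Tensor.

Arguments tens {k V W}.
(* V \ox W denotes the vector space, i.e. the canonical lmodType of tensor V W. *)
Notation "V \ox W" := (Defs_tensor__canonical__GRing_Lmodule V W) : type_scope.
Notation "v *t w" := (tens v w) : ring_scope.


Section TensorMaps.
Variable k : fieldType.

Section Map.
Variables (V V' W W' : lmodType k).

Definition tens_map_fun (f : {linear V -> V'}) (g : {linear W -> W'}) v w :=
  f v *t g w.

Lemma tens_map_bilinear f g : bilinear_for *:%R *:%R (tens_map_fun f g).
Proof.
split=> [w a v v'|v a w w']; rewrite /tens_map_fun /=.
  by rewrite linearP tensDl tensZl.
by rewrite linearP tensDr tensZr.
Qed.

HB.instance Definition _ f g := bilinear_isBilinear.Build k V W (V' \ox W')
  *:%R *:%R (tens_map_fun f g) (tens_map_bilinear f g).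

Definition tens_map (f : {linear V -> V'}) (g : {linear W -> W'}) :
  V \ox W -> V' \ox W' := tens_lift (tens_map_fun f g).
HB.instance Definition _ f g := GRing.Linear.on (tens_map f g).

Lemma tens_mapE f g v w : tens_map f g (v *t w) = f v *t g w.
Proof. exact: tens_liftE. Qed.
End Map.

Section Assoc.
Variables (U V W : lmodType k).

Definition tens_assoc_fun (x : U \ox V) (w : W) : U \ox (V \ox W) :=
  tens_map idfun (applyr tens w) x.

Lemma tens_assoc_bilinear : bilinear_for *:%R *:%R tens_assoc_fun.
Proof.
split=> [w a x y|x a w w']; rewrite /tens_assoc_fun /=; first exact: linearP.
elim/tens_ind: x => [u v||x y IHx IHy].
- by rewrite !tens_mapE /= /applyr /= linearPr linearPr.
- by rewrite !linear0 addr0.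
- by rewrite !linearD /= IHx IHy addrACA.
Qed.

HB.instance Definition _ := bilinear_isBilinear.Build k (U \ox V) W _
  *:%R *:%R tens_assoc_fun tens_assoc_bilinear.

Definition tens_assoc : (U \ox V) \ox W -> U \ox (V \ox W) :=
  tens_lift tens_assoc_fun.
HB.instance Definition _ := GRing.Linear.on tens_assoc.

Lemma tens_assocE u v w : tens_assoc (u *t v *t w) = u *t (v *t w).
Proof. by rewrite /tens_assoc tens_liftE; exact: tens_mapE. Qed.
End Assoc.


Section Contract.
Variables (V C : lmodType k).

Definition contract_r_fun (a : {linear C -> k^o}) (v : V) (c : C) : V :=
  (a c : k) *: v.
Definition contract_l_fun (a : {linear C -> k^o}) (c : C) (v : V) : V :=
  (a c : k) *: v.

Lemma contract_r_bilinear a : bilinear_for *:%R *:%R (contract_r_fun a).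
Proof.
split=> [c b v v'|v b c c']; rewrite /contract_r_fun /=.
  by rewrite scalerDr !scalerA mulrC.
by rewrite linearP scalerDl scalerA.
Qed.

Lemma contract_l_bilinear a : bilinear_for *:%R *:%R (contract_l_fun a).
Proof.
split=> [v b c c'|c b v v']; rewrite /contract_l_fun /=.
  by rewrite linearP scalerDl scalerA.
by rewrite scalerDr !scalerA mulrC.
Qed.

HB.instance Definition _ a := bilinear_isBilinear.Build k V C V
  *:%R *:%R (contract_r_fun a) (contract_r_bilinear a).
HB.instance Definition _ a := bilinear_isBilinear.Build k C V V
  *:%R *:%R (contract_l_fun a) (contract_l_bilinear a).

(* v *t c |-> a(c) v, i.e. (1 \ox a) followed by V \ox k ~ V, and
   c *t v |-> a(c) v, i.e. (a \ox 1) followed by k \ox V ~ V *)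
Definition contract_r a : V \ox C -> V := tens_lift (contract_r_fun a).
Definition contract_l a : C \ox V -> V := tens_lift (contract_l_fun a).
HB.instance Definition _ a := GRing.Linear.on (contract_r a).
HB.instance Definition _ a := GRing.Linear.on (contract_l a).

Lemma contract_rE a v c : contract_r a (v *t c) = (a c : k) *: v.
Proof. exact: tens_liftE. Qed.
Lemma contract_lE a c v : contract_l a (c *t v) = (a c : k) *: v.
Proof. exact: tens_liftE. Qed.
End Contract.

Section Form.
Variables (V W : lmodType k).
Definition form_mul_fun (a : {linear V -> k^o}) (b : {linear W -> k^o}) v w : k^o :=
  (a v : k) * (b w : k).

Lemma form_mul_bilinear a b : bilinear_for *:%R *:%R (form_mul_fun a b).
Proof.
split=> [w c v v'|v c w w']; rewrite /form_mul_fun /= linearP.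
  by rewrite mulrDl -mulrA.
by rewrite mulrDr mulrCA.
Qed.

HB.instance Definition _ a b := bilinear_isBilinear.Build k V W k^o
  *:%R *:%R (form_mul_fun a b) (form_mul_bilinear a b).

(* v *t w |-> a(v) b(w) *)
Definition form_mul a b : V \ox W -> k^o := tens_lift (form_mul_fun a b).
HB.instance Definition _ a b := GRing.Linear.on (form_mul a b).

Lemma form_mulE a b v w : form_mul a b (v *t w) = (a v : k) * (b w : k).
Proof. exact: tens_liftE. Qed.
End Form.

End TensorMaps.
Arguments tens_assoc {k U V W}.

HB.mixin Record isCoalgebra (k : fieldType) C of GRing.Lmodule k C := {
  comul : {linear C -> C \ox C};
  counit : {linear C -> k^o};
  comulA : forall c,
    tens_assoc (tens_map comul idfun (comul c))
    = tens_map idfun comul (comul c);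
  counitl : forall c, contract_l counit (comul c) = c;
  counitr : forall c, contract_r counit (comul c) = c
}.

#[short(type="coalgType")]
HB.structure Definition Coalgebra (k : fieldType) :=
  {C of isCoalgebra k C & GRing.Lmodule k C}.

HB.mixin Record isRComodule (k : fieldType) (C : coalgType k) M
    of GRing.Lmodule k M := {
  rcoact : {linear M -> M \ox C};
  rcoactA : forall m,
    tens_assoc (tens_map rcoact idfun (rcoact m))
    = tens_map idfun comul (rcoact m);
  rcoact1 : forall m, contract_r counit (rcoact m) = m
}.

#[short(type="rcomodType")]
HB.structure Definition RComodule (k : fieldType) (C : coalgType k) :=
  {M of isRComodule k C M & GRing.Lmodule k M}.

HB.mixin Record isLComodule (k : fieldType) (C : coalgType k) N
    of GRing.Lmodule k N := {
  lcoact : {linear N -> C \ox N};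
  lcoactA : forall n,
    tens_assoc (tens_map comul idfun (lcoact n))
    = tens_map idfun lcoact (lcoact n);
  lcoact1 : forall n, contract_l counit (lcoact n) = n
}.

#[short(type="lcomodType")]
HB.structure Definition LComodule (k : fieldType) (C : coalgType k) :=
  {N of isLComodule k C N & GRing.Lmodule k N}.

Record rcomodHom (k : fieldType) (C : coalgType k) (M M' : rcomodType C) := {
  rhom_map :> {linear M -> M'};
  rhom_coact : forall m, rcoact (rhom_map m) = tens_map rhom_map idfun (rcoact m)
}.

Record lcomodHom (k : fieldType) (C : coalgType k) (N N' : lcomodType C) := {
  lhom_map :> {linear N -> N'};
  lhom_coact : forall n, lcoact (lhom_map n) = tens_map idfun lhom_map (lcoact n)
}.

Section Cotensor.
Variables (k : fieldType) (C : coalgType k).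

Section Def.
Variables (M : rcomodType C) (N : lcomodType C).

(* Delta_M \ox 1 - 1 \ox Delta_N *)
Definition cotensor_diff : {linear M \ox N -> M \ox (C \ox N)} :=
  (tens_assoc \o tens_map rcoact idfun) \- tens_map idfun lcoact.

Definition cotensor_ker : {pred (M \ox N)} := [pred x | cotensor_diff x == 0].

Lemma cotensor_submod : submod_closed cotensor_ker.
Proof.
split=> [|a x y]; rewrite !inE; first by rewrite linear0.
by move=> /eqP x0 /eqP y0; rewrite linearP x0 y0 scaler0 addr0.
Qed.

HB.instance Definition _ :=
  GRing.isSubmodClosed.Build k (M \ox N) cotensor_ker cotensor_submod.

Record cotensor := Cotensor { cotensor_val :> M \ox N; _ : cotensor_val \in cotensor_ker }.

HB.instance Definition _ := [isSub for cotensor_val].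
HB.instance Definition _ := [Choice of cotensor by <:].
HB.instance Definition _ := [SubChoice_isSubLmodule of cotensor by <:].

Lemma cotensorP (x : cotensor) :
  tens_assoc (tens_map rcoact idfun (val x)) = tens_map idfun lcoact (val x).
Proof. by apply/eqP; rewrite -subr_eq0; exact: (valP x). Qed.
End Def.
End Cotensor.

Arguments cotensor_ker {k C} M N.
Arguments cotensor {k C} M N.

(* Hom_k(C, k) with the product (a b)(c) = \sum a(c_1) b(c_2). It is only a
   pzRingType (with a k-vector space structure): for C = 0 it is the zero ring,
   which algType excludes. *)

Definition dual_alg (k : fieldType) (C : lmodType k) : Type := {linear C -> k^o}.

Section DualAlgebra.
Variables (k : fieldType) (C : coalgType k).

HB.instance Definition _ := GRing.Lmodule.on (dual_alg C).

Implicit Types a b c : dual_alg C.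

Definition dual_mul a b : dual_alg C := form_mul a b \o comul.
Definition dual_one : dual_alg C := counit.

Lemma dual_mulA : associative dual_mul.
Proof.
move=> a b c; apply: linear_ext => x /=.
have -> y : form_mul a (dual_mul b c) y
    = form_mul a (form_mul b c) (tens_map idfun comul y).
  rewrite -[RHS]/((_ \o _) y); apply: tens_lin_ext => u v /=.
  by rewrite tens_mapE !form_mulE.
rewrite -comulA.
have -> y : form_mul (dual_mul a b) c y
    = form_mul (form_mul a b) c (tens_map comul idfun y).
  rewrite -[RHS]/((_ \o _) y); apply: tens_lin_ext => u v /=.
  by rewrite tens_mapE !form_mulE.
elim/tens_ind: (tens_map _ _ _) => [y w||y y' IH IH'].
- elim/tens_ind: y => [u v||y y' IH IH'].
  + by rewrite tens_assocE !form_mulE /= !form_mulE mulrA.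
  + by rewrite linear0l !linear0.
  + by rewrite linearDl !linearD /= IH IH'.
- by rewrite !linear0.
- by rewrite !linearD /= IH IH'.
Qed.

Lemma dual_mul1 : left_id dual_one dual_mul.
Proof.
move=> a; apply: linear_ext => x /=; rewrite -[in RHS](counitl x).
move: (comul x) => y; rewrite -[RHS]/((_ \o _) y).
by apply: tens_lin_ext => u v /=; rewrite form_mulE contract_lE linearZ.
Qed.

Lemma dual_mul1r : right_id dual_one dual_mul.
Proof.
move=> a; apply: linear_ext => x /=; rewrite -[in RHS](counitr x).
move: (comul x) => y; rewrite -[RHS]/((_ \o _) y).
by apply: tens_lin_ext => u v /=; rewrite form_mulE contract_rE linearZ mulrC.
Qed.

Lemma dual_mulDl : left_distributive dual_mul +%R.
Proof.
move=> a b c; apply: linear_ext => x /=.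
move: (comul x) => y; rewrite -[RHS]/((_ \+ _) y).
by apply: tens_lin_ext => u v /=; rewrite !form_mulE mulrDl.
Qed.

Lemma dual_mulDr : right_distributive dual_mul +%R.
Proof.
move=> a b c; apply: linear_ext => x /=.
move: (comul x) => y; rewrite -[RHS]/((_ \+ _) y).
by apply: tens_lin_ext => u v /=; rewrite !form_mulE mulrDr.
Qed.

HB.instance Definition _ := GRing.Zmodule_isPzRing.Build (dual_alg C)
  dual_mulA dual_mul1 dual_mul1r dual_mulDl dual_mulDr.

Lemma dual_scaleAl (d : k) a b : d *: (a * b) = (d *: a) * b.
Proof.
apply: linear_ext => x /=.
move: (comul x) => y; rewrite -[LHS]/((_ \*: _) y).
by apply: tens_lin_ext => u v /=; rewrite !form_mulE lin_scaleE -mulrA.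
Qed.

Lemma dual_scaleAr (d : k) a b : d *: (a * b) = a * (d *: b).
Proof.
apply: linear_ext => x /=.
move: (comul x) => y; rewrite -[LHS]/((_ \*: _) y).
by apply: tens_lin_ext => u v /=; rewrite !form_mulE lin_scaleE mulrCA.
Qed.

Lemma dual_mulE a b (c : C) : (a * b) c = form_mul a b (comul c).
Proof. by []. Qed.
Lemma dual_oneE (c : C) : (1 : dual_alg C) c = counit c.
Proof. by []. Qed.

Definition dual_mul_map (a b : dual_alg C) : dual_alg C := a * b.

Lemma dual_mul_map_bilinear : bilinear_for *:%R *:%R dual_mul_map.
Proof.
split=> [b c a a'|a c b b']; rewrite /dual_mul_map.
  by rewrite mulrDl -dual_scaleAl.
by rewrite mulrDr -dual_scaleAr.
Qed.

HB.instance Definition _ := bilinear_isBilinear.Build k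
  (dual_alg C) (dual_alg C) (dual_alg C) *:%R *:%R
  dual_mul_map dual_mul_map_bilinear.
HB.instance Definition _ a := GRing.isLinear.Build k (dual_alg C) (dual_alg C)
  *:%R (dual_mul_map a) (dual_mul_map_bilinear.2 a).

End DualAlgebra.

(* A^e = A \ox A^op for A = Hom_k(C, k), with A^op the converse ring A^c. *)

Section EnvelopingAlgebra.
Variables (k : fieldType) (C : coalgType k).
Local Notation A := (dual_alg C).

HB.instance Definition _ := GRing.Zmodule_isLmodule.Build k A^c
  (@scalerA k A) (@scale1r k A) (@scalerDr k A) (@scalerDl k A).

Definition op_mul_map (a b : A^c) : A^c := a * b.

Lemma op_mul_map_bilinear : bilinear_for *:%R *:%R op_mul_map.
Proof.
split=> [b c a a'|a c b b']; rewrite /op_mul_map.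
  by rewrite mulrDl [in RHS]/GRing.mul /= dual_scaleAr.
by rewrite mulrDr [in RHS]/GRing.mul /= dual_scaleAl.
Qed.

HB.instance Definition _ := bilinear_isBilinear.Build k A^c A^c A^c
  *:%R *:%R op_mul_map op_mul_map_bilinear.
HB.instance Definition _ a := GRing.isLinear.Build k A^c A^c
  *:%R (op_mul_map a) (op_mul_map_bilinear.2 a).

Implicit Types x y z : A \ox A^c.

Definition env_mul_fun y (a : A) (b : A^c) : A \ox A^c :=
  tens_map (dual_mul_map a) (op_mul_map b) y.

Lemma env_mul_bilinear y : bilinear_for *:%R *:%R (env_mul_fun y).
Proof.
split=> [b c a a'|a c b b']; rewrite /env_mul_fun /=;
  elim/tens_ind: y => [u v||x y IHx IHy].
- by rewrite !tens_mapE /= linearPl tensDl tensZl.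
- by rewrite !linear0 ?scaler0 ?addr0.
- by rewrite !linearD /= IHx IHy addrACA.
- by rewrite !tens_mapE /= linearPl tensDr tensZr.
- by rewrite !linear0 ?scaler0 ?addr0.
- by rewrite !linearD /= IHx IHy addrACA.
Qed.

HB.instance Definition _ y := bilinear_isBilinear.Build k A A^c (A \ox A^c)
  *:%R *:%R (env_mul_fun y) (env_mul_bilinear y).

Definition env_mul x y : A \ox A^c := tens_lift (env_mul_fun y) x.
Definition env_one : A \ox A^c := (1 : A) *t (1 : A^c).

Lemma env_mulE a b a' b' :
  env_mul (a *t b) (a' *t b') = (a * a') *t (b * b').
Proof. by rewrite /env_mul tens_liftE; exact: tens_mapE. Qed.

Lemma env_mulP : bilinear_for *:%R *:%R env_mul.
Proof.
split=> [y c x x'|x c y y']; first exact: linearP.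
elim/tens_ind: x => [u v||x x' IHx IHx'].
- by rewrite /env_mul !tens_liftE /= /env_mul_fun linearP.
- by rewrite /env_mul /= !linear0 ?scaler0 addr0.
- by rewrite /env_mul in IHx IHx' *; rewrite /= !linearD /= IHx IHx' addrACA.
Qed.

HB.instance Definition _ := bilinear_isBilinear.Build k
  (A \ox A^c) (A \ox A^c) (A \ox A^c) *:%R *:%R env_mul env_mulP.

Lemma env_mulA : associative env_mul.
Proof.
move=> x y z; elim/tens_ind: x => [a b||x x' IH IH']; last 2 first.
- by rewrite !linear0l.
- by rewrite !linearDl /= IH IH'.
elim/tens_ind: y => [a' b'||x x' IH IH']; last 2 first.
- by rewrite linear0l linear0r linear0l.
- by rewrite linearDl !linearDr linearDl /= IH IH'.
elim/tens_ind: z => [a'' b''||x x' IH IH']; last 2 first.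
- by rewrite !linear0r.
- by rewrite !linearDr /= IH IH'.
by rewrite !env_mulE !mulrA.
Qed.

Lemma env_mul1 : left_id env_one env_mul.
Proof.
elim/tens_ind=> [a b||x y IHx IHy]; first by rewrite env_mulE !mul1r.
  by rewrite linear0r.
by rewrite linearDr /= IHx IHy.
Qed.

Lemma env_mul1r : right_id env_one env_mul.
Proof.
elim/tens_ind=> [a b||x y IHx IHy]; first by rewrite env_mulE !mulr1.
  by rewrite linear0l.
by rewrite linearDl /= IHx IHy.
Qed.

Lemma env_mulDl : left_distributive env_mul +%R.
Proof. by move=> x y z; rewrite linearDl. Qed.
Lemma env_mulDr : right_distributive env_mul +%R.
Proof. by move=> x y z; rewrite linearDr. Qed.

Definition env_alg : Type := A \ox A^c.
HB.instance Definition _ := GRing.Lmodule.on env_alg.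
HB.instance Definition _ := GRing.Zmodule_isPzRing.Build env_alg
  env_mulA env_mul1 env_mul1r env_mulDl env_mulDr.

Lemma env_scaleAl (c : k) (x y : env_alg) : c *: (x * y) = (c *: x) * y.
Proof. by rewrite /GRing.mul /= linearZl_LR. Qed.
Lemma env_scaleAr (c : k) (x y : env_alg) : c *: (x * y) = x * (c *: y).
Proof. by rewrite /GRing.mul /= linearZr_LR. Qed.

Lemma env_mulM (a a' : A) (b b' : A^c) :
  (a *t b : env_alg) * (a' *t b' : env_alg) = (a * a') *t (b * b').
Proof. exact: env_mulE. Qed.
Lemma env_1E : (1 : env_alg) = (1 : A) *t (1 : A^c). Proof. by []. Qed.

End EnvelopingAlgebra.

Arguments env_alg {k} C.

(* Bimodules over A = dual_alg C whose two k-actions agree (both coincide with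
   the given one); env_mod turns them into modules over A^e. *)

HB.mixin Record isBimodule (k : fieldType) (C : coalgType k) X
    of GRing.Lmodule k X := {
  lact : dual_alg C -> X -> X;
  ract : X -> dual_alg C -> X;
  lact_bilinear : bilinear_for *:%R *:%R lact;
  ract_bilinear : bilinear_for *:%R *:%R ract;
  lactM : forall a b x, lact (a * b) x = lact a (lact b x);
  lact1 : forall x, lact 1 x = x;
  ractM : forall x a b, ract x (a * b) = ract (ract x a) b;
  ract1 : forall x, ract x 1 = x;
  lractA : forall a x b, ract (lact a x) b = lact a (ract x b)
}.

#[short(type="bimodType")]
HB.structure Definition Bimodule (k : fieldType) (C : coalgType k) :=
  {X of isBimodule k C X & GRing.Lmodule k X}.

Definition env_mod (k : fieldType) (C : coalgType k) (X : bimodType C) : Type := X.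

Section EnvModule.
Variables (k : fieldType) (C : coalgType k).
Local Notation A := (dual_alg C).

Section Def.
Variable X : bimodType C.

HB.instance Definition _ := GRing.Zmodule.on (env_mod X).

Definition env_act_fun (x : X) (a : A) (b : A^c) : X := lact a (ract x b).

Lemma env_act_bilinear x : bilinear_for *:%R *:%R (env_act_fun x).
Proof.
split=> [b c a a'|a c b b']; rewrite /env_act_fun.
  exact: (lact_bilinear.1 _ c a a').
have -> : ract x (c *: b + b') = c *: ract x b + ract x b'.
  exact: (ract_bilinear.2 x c b b').
exact: (lact_bilinear.2 a c).
Qed.

HB.instance Definition _ x := bilinear_isBilinear.Build k A A^c X
  *:%R *:%R (env_act_fun x) (env_act_bilinear x).

(* (a *t b) x = a x b *)
Definition env_act (t : env_alg C) (x : X) : X := tens_lift (env_act_fun x) t.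

Lemma env_actE a b x : env_act (a *t b) x = lact a (ract x b).
Proof. exact: tens_liftE. Qed.

Lemma env_act_linearl x : linear (env_act^~ x).
Proof. by move=> c s t; rewrite /env_act linearP. Qed.

Lemma env_act_linearr t : linear (env_act t).
Proof.
move=> c x y; elim/tens_ind: t => [a b||s t IHs IHt].
- rewrite !env_actE (ract_bilinear.1 b c x y); exact: (lact_bilinear.2 a c).
- by rewrite /env_act !linear0 ?scaler0 addr0.
- have D z : env_act (s + t) z = env_act s z + env_act t z.
    by rewrite /env_act linearD.
  by rewrite !D IHs IHt scalerDr addrACA.
Qed.

Lemma env_actA s t x : env_act s (env_act t x) = env_act (s * t) x.
Proof.
have D u v z : env_act (u + v) z = env_act u z + env_act v z.
  by rewrite /env_act linearD.
have Dr u z z' : env_act u (z + z') = env_act u z + env_act u z'.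
  by have := env_act_linearr u 1 z z'; rewrite !scale1r.
have Z z : env_act 0 z = 0 by rewrite /env_act linear0.
have Zr u : env_act u 0 = 0.
  by have := env_act_linearr u (-1) 0 0; rewrite !scaleN1r oppr0 addr0 addNr.
elim/tens_ind: s => [a b||u v IHu IHv]; last 2 first.
- by rewrite Z [0 * t]mul0r Z.
- by rewrite D IHu IHv -D [(u + v : env_alg C) * t]mulrDl.
elim/tens_ind: t => [a' b'||u v IHu IHv]; last 2 first.
- by rewrite Z Zr [_ * 0]mulr0 Z.
- by rewrite D Dr IHu IHv -D [_ * (u + v : env_alg C)]mulrDr.
rewrite env_mulM !env_actE lactM lractA; congr (lact a (lact a' _)).
exact/esym/(ractM x b' b).
Qed.

Lemma env_act1 : left_id 1 env_act.
Proof. by move=> x; rewrite env_1E env_actE ract1 lact1. Qed.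

Lemma env_actDr : right_distributive env_act +%R.
Proof. by move=> t x y; have := env_act_linearr t 1 x y; rewrite !scale1r. Qed.

Lemma env_actDl x : {morph env_act^~ x : s t / s + t}.
Proof. by move=> s t; have := env_act_linearl x 1 s t; rewrite !scale1r. Qed.

HB.instance Definition _ := GRing.Zmodule_isLmodule.Build (env_alg C) (env_mod X)
  env_actA env_act1 env_actDr env_actDl.

End Def.

(* Hom_{A^e}(X, Y), with its pointwise k-vector space structure *)
Definition hom_env (X Y : bimodType C) : Type := {linear env_mod X -> env_mod Y}.

Section Hom.
Variables X Y : bimodType C.

HB.instance Definition _ := GRing.Zmodule.on (hom_env X Y).

Definition hom_env_fun (f : hom_env X Y) : X -> Y := f.

Definition hom_scale_fun (c : k) (f : hom_env X Y) : env_mod X -> env_mod Y :=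
  fun x => c *: (hom_env_fun f x).

Lemma hom_scale_linear c f : linear (hom_scale_fun c f).
Proof.
move=> t x y; rewrite /hom_scale_fun /hom_env_fun linearP.
rewrite [LHS](scalerDr c (_ : Y) (_ : Y)); congr (_ + _).
have /= := env_act_linearr t c (f x : Y) 0.
have -> : env_act t (0 : Y) = 0 by exact: (scaler0 (env_mod Y) t).
by rewrite !addr0 => <-.
Qed.

HB.instance Definition _ c f := GRing.isLinear.Build (env_alg C)
  (env_mod X) (env_mod Y) *:%R (hom_scale_fun c f) (hom_scale_linear c f).

Definition hom_scale (c : k) (f : hom_env X Y) : hom_env X Y := hom_scale_fun c f.

Lemma hom_scaleA a b f : hom_scale a (hom_scale b f) = hom_scale (a * b) f.
Proof. by apply: linear_ext => x; exact: (scalerA a b (hom_env_fun f x)). Qed.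
Lemma hom_scale1 : left_id 1 hom_scale.
Proof. by move=> f; apply: linear_ext => x; exact: (scale1r (hom_env_fun f x)). Qed.
Lemma hom_scaleDr : right_distributive hom_scale +%R.
Proof.
move=> a f g; apply: linear_ext => x.
exact: (scalerDr a (hom_env_fun f x) (hom_env_fun g x)).
Qed.
Lemma hom_scaleDl f : {morph hom_scale^~ f : a b / a + b}.
Proof.
by move=> a b; apply: linear_ext => x; exact: (scalerDl (hom_env_fun f x) a b).
Qed.

HB.instance Definition _ := GRing.Zmodule_isLmodule.Build k (hom_env X Y)
  hom_scaleA hom_scale1 hom_scaleDr hom_scaleDl.
End Hom.
End EnvModule.


Definition dual_bimod (k : fieldType) (C : coalgType k) : Type := dual_alg C.

Section DualBimodule.
Variables (k : fieldType) (C : coalgType k).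
Local Notation A := (dual_alg C).

HB.instance Definition _ := GRing.Lmodule.on (dual_bimod C).

HB.instance Definition _ := isBimodule.Build k C (dual_bimod C)
  (@dual_mul_map_bilinear k C) (@dual_mul_map_bilinear k C)
  (fun a b x => esym (mulrA (a : A) b x)) (@mul1r A)
  (fun x a b => mulrA (x : A) a b) (@mulr1 A)
  (fun a x b => esym (mulrA (a : A) x b)).
End DualBimodule.


Section ComoduleActions.
Variables (k : fieldType) (C : coalgType k).
Local Notation A := (dual_alg C).

Section Left.
Variable M : rcomodType C.

(* a m = \sum m_0 a(m_1) *)
Definition rcomod_lact (a : A) (m : M) : M := contract_r a (rcoact m).

Lemma rcomod_lact_bilinear : bilinear_for *:%R *:%R rcomod_lact.
Proof.
split=> [m c a b|a c m m']; last by rewrite /rcomod_lact !linearP.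
rewrite /rcomod_lact; move: (rcoact m) => y; rewrite -[RHS]/((c \*: _ \+ _) y).
apply: tens_lin_ext => u v /=.
by rewrite !contract_rE scalerDl scalerA.
Qed.

HB.instance Definition _ a := GRing.isLinear.Build k M M *:%R
  (rcomod_lact a) (rcomod_lact_bilinear.2 a).

Lemma rcomod_lactM a b m :
  rcomod_lact (a * b) m = rcomod_lact a (rcomod_lact b m).
Proof.
rewrite /rcomod_lact.
have -> y : contract_r (a * b : A) y
    = contract_r (form_mul a b) (tens_map idfun comul y) :> M.
  rewrite -[RHS]/((_ \o _) y); apply: tens_lin_ext => u v /=.
  by rewrite tens_mapE !contract_rE.
have -> y : contract_r a (rcoact (contract_r b y))
    = contract_r a (contract_r b (tens_map rcoact idfun y)) :> M.
  rewrite -[RHS]/((contract_r a \o (contract_r b \o tens_map rcoact idfun)) y).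
  rewrite -[LHS]/((contract_r a \o (rcoact \o contract_r b)) y).
  apply: tens_lin_ext => u v /=.
  by rewrite tens_mapE !contract_rE linearZ.
rewrite -rcoactA.
elim/tens_ind: (tens_map _ _ _) => [y w||y y' IH IH'].
- elim/tens_ind: y => [u v||y y' IH IH'].
  + rewrite tens_assocE !contract_rE linearZ /= contract_rE form_mulE.
    by rewrite scalerA mulrC.
  + by rewrite linear0l !linear0.
  + by rewrite linearDl !linearD /= IH IH'.
- by rewrite !linear0.
- by rewrite !linearD /= IH IH'.
Qed.

Lemma rcomod_lact1 m : rcomod_lact 1 m = m.
Proof. exact: rcoact1. Qed.
End Left.

Section Right.
Variable N : lcomodType C.

(* n a = \sum a(n_{-1}) n_0 *)
Definition lcomod_ract (a : A) (n : N) : N := contract_l a (lcoact n).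

Lemma lcomod_ract_bilinear : bilinear_for *:%R *:%R lcomod_ract.
Proof.
split=> [n c a b|a c n n']; last by rewrite /lcomod_ract !linearP.
rewrite /lcomod_ract; move: (lcoact n) => y; rewrite -[RHS]/((c \*: _ \+ _) y).
apply: tens_lin_ext => u v /=.
by rewrite !contract_lE scalerDl scalerA.
Qed.

HB.instance Definition _ a := GRing.isLinear.Build k N N *:%R
  (lcomod_ract a) (lcomod_ract_bilinear.2 a).

Lemma lcomod_ractM a b n :
  lcomod_ract (a * b) n = lcomod_ract b (lcomod_ract a n).
Proof.
rewrite /lcomod_ract.
have -> y : contract_l (a * b : A) y
    = contract_l (form_mul a b) (tens_map comul idfun y) :> N.
  rewrite -[RHS]/((_ \o _) y); apply: tens_lin_ext => u v /=.
  by rewrite tens_mapE !contract_lE.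
have -> y : contract_l b (lcoact (contract_l a y))
    = contract_l b (contract_l a (tens_map idfun lcoact y)) :> N.
  rewrite -[RHS]/((contract_l b \o (contract_l a \o tens_map idfun lcoact)) y).
  rewrite -[LHS]/((contract_l b \o (lcoact \o contract_l a)) y).
  apply: tens_lin_ext => u v /=.
  by rewrite tens_mapE !contract_lE linearZ.
rewrite -lcoactA.
elim/tens_ind: (tens_map _ _ _) => [y w||y y' IH IH'].
- elim/tens_ind: y => [u v||y y' IH IH'].
  + rewrite tens_assocE !contract_lE linearZ /= contract_lE form_mulE.
    by rewrite scalerA.
  + by rewrite linear0l !linear0.
  + by rewrite linearDl !linearD /= IH IH'.
- by rewrite !linear0.
- by rewrite !linearD /= IH IH'.
Qed.

Lemma lcomod_ract1 n : lcomod_ract 1 n = n.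
Proof. exact: lcoact1. Qed.
End Right.

Section TensorBimodule.
Variables (M : rcomodType C) (N : lcomodType C).

(* a (m *t n) = a m *t n and (m *t n) a = m *t n a *)
Definition comod_tens_lact (a : A) : M \ox N -> M \ox N :=
  tens_map (rcomod_lact a) idfun.
Definition comod_tens_ract (x : M \ox N) (a : A) : M \ox N :=
  tens_map idfun (lcomod_ract a) x.

Lemma comod_tens_lact_bilinear : bilinear_for *:%R *:%R comod_tens_lact.
Proof.
split=> [x c a b|a c x y] /=; last by rewrite /comod_tens_lact linearP.
rewrite /comod_tens_lact; elim/tens_ind: x => [m n||x y IHx IHy].
- by rewrite !tens_mapE /= [rcomod_lact _ m]((rcomod_lact_bilinear M).1 m c a b) tensDl tensZl.
- by rewrite !linear0 ?scaler0 addr0.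
- by rewrite !linearD /= IHx IHy addrACA.
Qed.

Lemma comod_tens_ract_bilinear : bilinear_for *:%R *:%R comod_tens_ract.
Proof.
split=> [a c x y|x c a b] /=; first by rewrite /comod_tens_ract linearP.
rewrite /comod_tens_ract; elim/tens_ind: x => [m n||x y IHx IHy].
- by rewrite !tens_mapE /= [lcomod_ract _ n]((lcomod_ract_bilinear N).1 n c a b) tensDr tensZr.
- by rewrite !linear0 ?scaler0 addr0.
- by rewrite !linearD /= IHx IHy addrACA.
Qed.

Lemma comod_tens_lactM a b x :
  comod_tens_lact (a * b) x = comod_tens_lact a (comod_tens_lact b x).
Proof.
rewrite -[RHS]/((_ \o _) x); apply: tens_lin_ext => m n /=.
by rewrite !tens_mapE /= rcomod_lactM.
Qed.

Lemma comod_tens_lact1 x : comod_tens_lact 1 x = x.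
Proof.
rewrite -[RHS]/(idfun x); apply: tens_lin_ext => m n /=.
by rewrite tens_mapE /= rcomod_lact1.
Qed.

Lemma comod_tens_ractM x a b :
  comod_tens_ract x (a * b) = comod_tens_ract (comod_tens_ract x a) b.
Proof.
rewrite -[RHS]/((tens_map _ _ \o tens_map _ _) x); apply: tens_lin_ext => m n /=.
by rewrite !tens_mapE /= lcomod_ractM.
Qed.

Lemma comod_tens_ract1 x : comod_tens_ract x 1 = x.
Proof.
rewrite -[RHS]/(idfun x); apply: tens_lin_ext => m n /=.
by rewrite tens_mapE /= lcomod_ract1.
Qed.

Lemma comod_tens_lractA a x b :
  comod_tens_ract (comod_tens_lact a x) b = comod_tens_lact a (comod_tens_ract x b).
Proof.
rewrite -[RHS]/((tens_map _ _ \o tens_map _ _) x).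
rewrite -[LHS]/((tens_map _ _ \o tens_map _ _) x).
by apply: tens_lin_ext => m n /=; rewrite !tens_mapE.
Qed.

HB.instance Definition _ := isBimodule.Build k C (tensor M N)
  comod_tens_lact_bilinear comod_tens_ract_bilinear
  comod_tens_lactM comod_tens_lact1 comod_tens_ractM comod_tens_ract1
  comod_tens_lractA.

End TensorBimodule.
End ComoduleActions.


Section Functoriality.
Variables (k : fieldType) (C : coalgType k).
Variables (M M' : rcomodType C) (N N' : lcomodType C).
Variables (f : rcomodHom M M') (g : lcomodHom N N').

Lemma cotensor_map_subproof (x : cotensor M N) :
  tens_map f g (val x) \in cotensor_ker M' N'.
Proof.
rewrite inE /cotensor_diff /= subr_eq0; apply/eqP.
have El y : tens_assoc (tens_map rcoact idfun (tens_map f g y))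
    = tens_map f (tens_map idfun g) (tens_assoc (tens_map rcoact idfun y))
    :> M' \ox (C \ox N').
  rewrite -[RHS]/((tens_map f (tens_map idfun g) \o
    (tens_assoc \o tens_map rcoact idfun)) y).
  rewrite -[LHS]/((tens_assoc \o (tens_map rcoact idfun \o tens_map f g)) y).
  apply: tens_lin_ext => m n /=; rewrite !tens_mapE /= rhom_coact.
  elim/tens_ind: (rcoact m) => [m' c||z z' IH IH'].
  - by rewrite !tens_mapE !tens_assocE !tens_mapE /= tens_mapE.
  - by rewrite !(linear0, linear0l).
  - by rewrite !(linearD, linearDl) /= IH IH'.
have Er y : tens_map idfun lcoact (tens_map f g y)
    = tens_map f (tens_map idfun g) (tens_map idfun lcoact y)
    :> M' \ox (C \ox N').
  rewrite -[RHS]/((tens_map f (tens_map idfun g) \o tens_map idfun lcoact) y).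
  rewrite -[LHS]/((tens_map idfun lcoact \o tens_map f g) y).
  by apply: tens_lin_ext => m n /=; rewrite !tens_mapE /= lhom_coact.
by rewrite El Er cotensorP.
Qed.

(* the restriction of f \ox g *)
Definition cotensor_map (x : cotensor M N) : cotensor M' N' :=
  Cotensor (cotensor_map_subproof x).

Lemma tens_map_lact a (x : M \ox N) :
  tens_map f g (lact a x) = lact a (tens_map f g x : tensor M' N').
Proof.
rewrite -[RHS]/((tens_map (rcomod_lact a) idfun \o tens_map f g) x).
rewrite -[LHS]/((tens_map f g \o tens_map (rcomod_lact a) idfun) x).
apply: tens_lin_ext => m n /=; rewrite !tens_mapE /=; congr (_ *t _).
rewrite /rcomod_lact rhom_coact.
rewrite -[RHS]/((_ \o _) (rcoact m)) -[LHS]/((_ \o _) (rcoact m)).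
apply: tens_lin_ext => u c /=.
by rewrite tens_mapE !contract_rE linearZ.
Qed.

Lemma tens_map_ract a (x : M \ox N) :
  tens_map f g (ract x a) = ract (tens_map f g x : tensor M' N') a.
Proof.
rewrite -[RHS]/((tens_map idfun (lcomod_ract a) \o tens_map f g) x).
rewrite -[LHS]/((tens_map f g \o tens_map idfun (lcomod_ract a)) x).
apply: tens_lin_ext => m n /=; rewrite !tens_mapE /=; congr (_ *t _).
rewrite /lcomod_ract lhom_coact.
rewrite -[RHS]/((_ \o _) (lcoact n)) -[LHS]/((_ \o _) (lcoact n)).
apply: tens_lin_ext => c u /=.
by rewrite tens_mapE !contract_lE linearZ.
Qed.

(* f \ox g as a map of A^e-modules *)
Definition env_tens_map (x : env_mod (tensor M N)) : env_mod (tensor M' N') :=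
  tens_map f g x.

Lemma env_tens_map_linear : linear env_tens_map.
Proof.
move=> t x y; rewrite /env_tens_map.
have D z z' : tens_map f g (z + z') = tens_map f g z + tens_map f g z'.
  by rewrite linearD.
rewrite [LHS]D; congr (_ + _).
elim/tens_ind: t => [a b||s t IHs IHt].
- by rewrite [LHS](congr1 (tens_map f g) (env_actE a b x)) tens_map_lact
    tens_map_ract; exact/esym/env_actE.
- by rewrite !scale0r linear0.
- by rewrite !scalerDl -IHs -IHt; exact: D.
Qed.

HB.instance Definition _ := GRing.isLinear.Build (env_alg C)
  (env_mod (tensor M N)) (env_mod (tensor M' N')) *:%R
  env_tens_map env_tens_map_linear.

(* h |-> (f \ox g) \o h *)
Definition hom_env_map (X : bimodType C) (h : hom_env X (tensor M N)) :
  hom_env X (tensor M' N') := env_tens_map \o h.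

End Functoriality.

(* Main.v *)
(* An A^e-linear map h from A to M \ox N is determined by x = h 1, which may be
   any element with a x = x a for all a in A. Since a x and x a are obtained from
   (Delta_M \ox 1) x and (1 \ox Delta_N) x by applying a to the middle factor
   C, and since linear forms on a vector space separate points (Zorn), hence
   forms on C separate the elements of M \ox (C \ox N), this condition says
   exactly that x lies in the cotensor product. *)
Require Import Defs.
From HB Require Import structures.
From mathcomp Require Import all_boot all_algebra.
From mathcomp Require Import boolp.
From mathcomp Require classical_sets.

Set Implicit Arguments.
Unset Strict Implicit.
Unset Printing Implicit Defensive.

Import GRing.Theory.
Local Open Scope ring_scope.

(** * Linear forms separating a vector from a subspace *)

Section SeparatingForms.
Import classical_sets.
Local Open Scope classical_set_scope.
Variables (k : fieldType) (V : lmodType k).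

(** The empty set qualifies too, hence the separate hypothesis [W 0] in [separating_form]. *)
Definition linear_closed_set (W : set V) :=
  forall a x y, W x -> W y -> W (a *: x + y).

Lemma maximal_avoiding_subspace (W : set V) (c : V) :
    linear_closed_set W -> ~ W c ->
  exists H : set V, [/\ W `<=` H, linear_closed_set H, ~ H c &
    forall B : set V, H `<=` B -> linear_closed_set B -> ~ B c -> B `<=` H].
Proof.
move=> Wlin Wc.
(* Zorn_bigcup includes the empty chain, whose union is not a subspace: hence
   A `|` W rather than A. *)
pose P (A : set V) := linear_closed_set (A `|` W) /\ ~ (A `|` W) c.
have [F FP Ftot|A [[Alin Ac] Amax]] := @Zorn_bigcup V P.
  split=> [a x y|[[X FX Xc]|//]]; last by have [_ []] := FP _ FX; left.
  (* Any two members of the chain are comparable, so both vectors can be placed in a single [X]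
     together with [W]. *)
  have inU X : F X -> (X `|` W) x -> (X `|` W) y ->
      (\bigcup_(X in F) X `|` W) (a *: x + y).
    move=> FX xX yX; have [Xlin _] := FP _ FX.
    by have [Xa|Wa] := Xlin a _ _ xX yX; [left; exists X|right].
  case=> [[X FX Xx]|Wx] [[Y FY Yy]|Wy].
  - have [XY|YX] := Ftot _ _ FX FY.
      by apply: (inU Y) => //; left; [exact: XY|].
    by apply: (inU X) => //; left; [|exact: YX].
  - by apply: (inU X) => //; [left|right].
  - by apply: (inU Y) => //; [right|left].
  - by right; exact: Wlin.
exists (A `|` W); split=> // B AB Blin Bc x Bx.
apply: contrapT => nx; apply: (Amax B).
  by split=> [u Au|BA]; [apply: AB; left | apply: nx; left; exact: BA].
have BW : B `|` W = B.
  by rewrite eqEsubset; split=> u; [case=> // Wu; apply: AB; right | left].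
by rewrite /P BW.
Qed.

(** A subspace [H] maximal among those containing [W] and avoiding [c] is a complement of the line
    spanned by [c]; the form reads off the coefficient along [c]. *)
Lemma separating_form (W : set V) (c : V) :
    W 0 -> linear_closed_set W -> ~ W c ->
  exists f : {linear V -> k^o}, f c = 1 /\ forall x, W x -> f x = 0.
Proof.
move=> W0 Wlin Wc.
have [H [WH Hlin Hc Hmax]] := maximal_avoiding_subspace Wlin Wc.
have H0 : H 0 by exact: WH.
have HZ a x : H x -> H (a *: x) by move=> Hx; rewrite -[_ *: _]addr0; exact: Hlin.
have decomp v : exists a : k, H (v - a *: c).
  apply: contrapT => nv.
  have nHv : ~ H v by move=> Hv; apply: nv; exists 0; rewrite scale0r subr0.
  (* [B] is [H + k v]. If it contained [c], then [c - b v] would lie in [H] with [b] nonzero, and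
     dividing by [b] would decompose [v]. *)
  pose B := [set u | exists a : k, H (u - a *: v)].
  apply: nHv; apply: (Hmax B); last by exists 1; rewrite scale1r subrr.
  - by move=> u Hu; exists 0; rewrite scale0r subr0.
  - move=> a x y [b xb] [d yd]; exists (a * b + d).
    have -> : a *: x + y - (a * b + d) *: v
        = a *: (x - b *: v) + (y - d *: v).
      by rewrite scalerBr scalerA scalerDl opprD addrACA.
    exact: Hlin.
  case=> b cb; have [b0|b0] := eqVneq b 0.
    by apply: Hc; move: cb; rewrite b0 scale0r subr0.
  apply: nv; exists b^-1; have := HZ (- b^-1) _ cb.
  by rewrite scaleNr scalerBr scalerA mulVf // scale1r opprB.
have uniq v a b : H (v - a *: c) -> H (v - b *: c) -> a = b.
  move=> va vb; apply: contrapT => /eqP; rewrite -subr_eq0 => ab.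
  apply: Hc; have := HZ (a - b)^-1 _ (Hlin (-1) _ _ va vb).
  rewrite scaleN1r opprB addrA subrK -scalerBl scalerA mulVf //.
  by rewrite scale1r.
have [f fP] := choice decomp.
have flin : linear (f : V -> k^o).
  move=> a x y; apply: (uniq (a *: x + y)) => //.
  rewrite scalerDl [X in - (X + _)]/(_ *: _).
  have -> : a *: x + y - ((a *: (f x : k^o) : k) *: c + f y *: c)
      = a *: (x - f x *: c) + (y - f y *: c).
    by rewrite scalerBr scalerA opprD addrACA.
  exact: Hlin.
pose L := GRing.isLinear.Build k V k^o *:%R f flin.
exists (HB.pack_for {linear V -> k^o} f L); split=> [|x Wx] /=.
  by apply: (uniq c) => //; rewrite scale1r subrr.
by apply: (uniq x) => //; rewrite scale0r subr0; exact: WH.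
Qed.

End SeparatingForms.

(** * Forms on the left factor detect zero tensors *)

Section TensorSeparation.
Variables (k : fieldType) (V W : lmodType k).

(** Induction on the number of terms: if [v ord0] is a combination of the other vectors, its term is
    absorbed into theirs; otherwise a form that kills the others and is 1 at [v ord0] yields
    [w ord0 = 0]. *)
Lemma sum_tens_eq0 n (v : 'I_n -> V) (w : 'I_n -> W) :
    (forall f : {linear V -> k^o}, contract_l f (\sum_i v i *t w i) = 0) ->
  \sum_i v i *t w i = 0.
Proof.
elim: n v w => [v w _|n IHn v w]; first by rewrite big_ord0.
rewrite big_ord_recl; set v' := fun i => v (lift ord0 i).
set w' := fun i => w (lift ord0 i) => fvw.
pose span u := exists c : 'I_n -> k, u = \sum_i c i *: v' i.
have [[c cP]|v0] := pselect (span (v ord0)).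
  have E : v ord0 *t w ord0 + \sum_i v' i *t w' i
      = \sum_i v' i *t (c i *: w ord0 + w' i).
    rewrite cP linear_sumlz -big_split /=; apply: eq_bigr => i _.
    by rewrite tensZl tensDr tensZr.
  by move: fvw; rewrite E; exact: IHn.
have span0 : span 0.
  by exists (fun=> 0); rewrite big1 // => i _; rewrite scale0r.
have spanlin : linear_closed_set span.
  move=> a _ _ [c ->] [d ->]; exists (fun i => a * c i + d i).
  rewrite scaler_sumr -big_split; apply: eq_bigr => i _ /=.
  by rewrite scalerDl scalerA.
have [f [f1 fspan]] := separating_form span0 spanlin v0.
have fv' i : f (v' i) = 0.
  apply: fspan; exists (fun j => (j == i)%:R); rewrite (bigD1 i) //= eqxx scale1r.
  by rewrite big1 ?addr0 // => j /negPf ->; rewrite scale0r.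
have w0 : w ord0 = 0.
  have := fvw f; rewrite linearD linear_sum /= contract_lE f1 scale1r.
  rewrite big1 ?addr0 // => i _.
  by rewrite contract_lE fv' scale0r.
move: fvw; rewrite w0 linear0r add0r; exact: IHn.
Qed.

Lemma contract_l_eq0 (x : V \ox W) :
  (forall f : {linear V -> k^o}, contract_l f x = 0) -> x = 0.
Proof.
elim/tens_ind_pi: x => s; rewrite tens_piE big_tnth; exact: sum_tens_eq0.
Qed.

End TensorSeparation.

(** * Central elements of the bimodule and homomorphisms out of [A] *)

Section CotensorHom.
Variables (k : fieldType) (C : coalgType k).
Local Notation A := (dual_alg C).

(** Contractions of [V] and of [C] commute, so separation is applied to each of these factors in
    turn. *)
Lemma contract_middle_eq0 (V W : lmodType k) (y : V \ox (C \ox W)) :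
  (forall a : A, tens_map idfun (contract_l a) y = 0 :> V \ox W) -> y = 0.
Proof.
move=> ay; apply: contract_l_eq0 => f; apply: contract_l_eq0 => a.
have -> z : contract_l a (contract_l f z)
    = contract_l f (tens_map idfun (contract_l a) z : V \ox W).
  rewrite -[LHS]/((_ \o _) z) -[RHS]/((_ \o _) z); apply: tens_lin_ext => v u /=.
  by rewrite tens_mapE !contract_lE linearZ.
by rewrite ay linear0.
Qed.

Lemma env_scaleE (X : bimodType C) (a : A) (b : A^c) (x : env_mod X) :
  (a *t b : env_alg C) *: x = lact a (ract (x : X) b).
Proof. exact: env_actE. Qed.

Lemma hom_env_lract (X Y : bimodType C) (h : hom_env X Y) a (x : X) b :
  (h : X -> Y) (lact a (ract x b)) = lact a (ract ((h : X -> Y) x) b).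
Proof.
by have := linearZ_LR h (a *t (b : A^c) : env_alg C) x; rewrite !env_scaleE.
Qed.

Section Bimodule.
Variables (M : rcomodType C) (N : lcomodType C).
Implicit Types x : tensor M N.

Lemma lact_contract a x :
  lact a x = tens_map idfun (contract_l a)
               (tens_assoc (tens_map rcoact idfun x)) :> tensor M N.
Proof.
rewrite -[LHS]/(tens_map (rcomod_lact a) idfun x).
rewrite -[RHS]/((tens_map _ _ \o (tens_assoc \o tens_map _ _)) x).
apply: tens_lin_ext => m n /=; rewrite !tens_mapE /= /rcomod_lact.
elim/tens_ind: (rcoact m) => [m' c||y z IHy IHz].
- by rewrite contract_rE tens_assocE tens_mapE /= contract_lE tensZl tensZr.
- by rewrite !(linear0, linear0l).
- by rewrite !(linearD, linearDl) /= IHy IHz.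
Qed.

Lemma ract_contract a x :
  ract x a = tens_map idfun (contract_l a) (tens_map idfun lcoact x)
    :> tensor M N.
Proof.
rewrite -[LHS]/(tens_map idfun (lcomod_ract a) x).
rewrite -[RHS]/((tens_map _ _ \o tens_map _ _) x).
by apply: tens_lin_ext => m n /=; rewrite !tens_mapE.
Qed.

Lemma cotensor_central x :
  x \in cotensor_ker M N <-> forall a, lact a x = ract x a.
Proof.
rewrite inE /cotensor_diff /= subr_eq0; split=> [/eqP xE a|xE].
  by rewrite lact_contract xE ract_contract.
apply/eqP/subr0_eq; apply: contract_middle_eq0 => a.
by rewrite linearB /= -lact_contract -ract_contract xE subrr.
Qed.

Section OrbitMap.
Variable x : cotensor M N.

Definition orbit_map (d : env_mod (dual_bimod C)) : env_mod (tensor M N) :=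
  lact (d : A) (val x).

Lemma orbit_map_linear : linear orbit_map.
Proof.
have D d e : orbit_map (d + e) = orbit_map d + orbit_map e.
  have := (@lact_bilinear _ _ (tensor M N)).1 (val x) 1 d e.
  by rewrite /= !scale1r.
move=> t d e; rewrite D; congr (_ + _).
elim/tens_ind: t => [a b||s t IHs IHt].
(* Centrality of [x] gives [a (d x) b = a d (x b) = a d (b x) = (a d b) x]. *)
- rewrite !env_scaleE /orbit_map lractA -(cotensor_central _).1 ?(valP x) // -!lactM.
  by congr (lact _ _); exact/esym/mulrA.
- by rewrite !scale0r /orbit_map; have := D 0 0; rewrite addr0 => /esym/eqP;
    rewrite -subr_eq0 addrK => /eqP.
- by rewrite !scalerDl D IHs IHt.
Qed.

HB.instance Definition _ := GRing.isLinear.Build (env_alg C)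
  (env_mod (dual_bimod C)) (env_mod (tensor M N)) *:%R
  orbit_map orbit_map_linear.

Definition orbit_hom : hom_env (dual_bimod C) (tensor M N) := orbit_map.

End OrbitMap.

Lemma orbit_hom_linear : linear orbit_hom.
Proof.
move=> c x y; apply: linear_ext => d.
exact: ((@lact_bilinear _ _ (tensor M N)).2 (d : A) c (val x) (val y)).
Qed.

HB.instance Definition _ := GRing.isLinear.Build k (cotensor M N)
  (hom_env (dual_bimod C) (tensor M N)) *:%R orbit_hom orbit_hom_linear.

(** Since [a 1 = 1 a] in [A], two-sided linearity gives [a h(1) = h(a) = h(1) a]. *)
Lemma hom_env_central (h : hom_env (dual_bimod C) (tensor M N)) :
  (h : dual_bimod C -> tensor M N) (1 : A) \in cotensor_ker M N.
Proof.
apply/cotensor_central => a.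
have := hom_env_lract h a (1 : A) 1; rewrite !ract1 => <-.
have := hom_env_lract h 1 (1 : A) a; rewrite !lact1 => <-.
by congr (h _); rewrite /lact /ract /=; exact: etrans (mulr1 a) (esym (mul1r a)).
Qed.

Definition eval1 h : cotensor M N := Cotensor (hom_env_central h).

Lemma orbit_homK : cancel orbit_hom eval1.
Proof. by move=> x; apply: val_inj; exact: lact1. Qed.

Lemma eval1K : cancel eval1 orbit_hom.
Proof.
move=> h; apply: linear_ext => a.
have := hom_env_lract h a (1 : A) 1; rewrite !ract1.
by rewrite [lact _ _](mulr1 a) => ->.
Qed.

End Bimodule.
End CotensorHom.

Theorem proposition4p1 (k : fieldType) (C : coalgType k) :
  exists Phi : forall (M : rcomodType C) (N : lcomodType C),
      {linear cotensor M N -> hom_env (dual_bimod C) (tensor M N)},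
    (forall (M : rcomodType C) (N : lcomodType C), bijective (Phi M N)) /\
    (forall (M M' : rcomodType C) (N N' : lcomodType C)
            (f : rcomodHom M M') (g : lcomodHom N N') (x : cotensor M N),
      Phi M' N' (cotensor_map f g x) = hom_env_map f g (Phi M N x)).
Proof.
exists (fun M N => @orbit_hom k C M N : {linear _ -> _}); split=> [M N|].
  exact: Bijective (@orbit_homK k C M N) (@eval1K k C M N).
move=> M M' N N' f g x; apply: linear_ext => a.
(* At [a], naturality says that [f \ox g] commutes with the left action of [a]. *)
exact/esym/tens_map_lact.
Qed.
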